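(* Let $I\subseteq\mathbb{R}$ be an interval of positive length and let $f,g\colon I\to\mathbb{R}$ be strictly increasing functions (not assumed continuous). Assume that there exists $n\in\mathbb{N}\setminus\{1\}$ such that $\mathscr{A}_f^{[n]}(x)=\mathscr{A}_g^{[n]}(x)$ for all $x\in I^n$, the mean $\mathscr{A}_f^{[n]}$ is passable, and the set $\operatorname{int}\mathcal{I}(\mathscr{A}_f^{[n]})$ is $(2,\mathscr{A}_f^{[n]})$-attracting. Then there exist $\alpha,\beta\in\mathbb{R}$ such that $f(x)=\alpha g(x)+\beta$ for all $x\in I$.
   Context: Here $\mathbb{N}=\{1,2,\dots\}$, $\operatorname{int}$ denotes the topological interior, and $\operatorname{conv}(S)$ is the smallest interval containing $S\subseteq\mathbb{R}$. Generalized inverse: for a strictly increasing $f\colon I\to\mathbb{R}$ (not necessarily continuous) there is a unique nondecreasing function $f^{(-1)}\colon\operatorname{conv}(f(I))\to I$ with $f^{(-1)}(f(x))=x$ for all $x\in I$; it is called the generalized inverse of $f$. Generalized quasiarithmetic mean: for $n\in\mathbb{N}$ and $x=(x_1,\dots,x_n)\in I^n$, $\mathscr{A}_f^{[n]}(x)=f^{(-1)}\Big(\frac{f(x_1)+\dots+f(x_n)}{n}\Big)$. It is a symmetric $n$-variable mean on $I$, i.e. a symmetric function $M\colon I^n\to I$ with $\min(x)\le M(x)\le\max(x)$ for all $x\in I^n$. For a symmetric mean $M\colon I^n\to I$: (1) A point $x\in I$ is an internality point of $M$ if for all $y_1,\dots,y_{n-1}\in I$, $M(x,y_1,\dots,y_{n-1})=x$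 implies either $y_1=\dots=y_{n-1}=x$ or $\min(y_1,\dots,y_{n-1})<x<\max(y_1,\dots,y_{n-1})$. The set of all internality points of $M$ is denoted $\mathcal{I}(M)$. (2) A set $V\subset I$ is $(k,M)$-attracting if for all $x_1,\dots,x_k\in V$ there exist $x_{k+1},\dots,x_n\in I$ such that $M(x_1,\dots,x_n)\in V$. (3) A point $t\in I$ is a passage point of $M$ if there exist $y_1,\dots,y_{n-1},z_1,\dots,z_{n-1}\in I$ such that for all $i\in\{1,\dots,n-1\}$ either $y_i=z_i$, or ($y_i<z_i$ and $[y_i,z_i]\subset\mathcal{I}(M)$), and $M(t,y_1,\dots,y_{n-1})<t<M(t,z_1,\dots,z_{n-1})$. The mean $M$ is passable if every $t\in I$ is a passage point of $M$. *)

(* Defs.v *)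
From HB Require Import structures.
From mathcomp Require Import all_boot all_order all_algebra.
From mathcomp Require Import all_classical all_reals all_analysis.

Set Implicit Arguments.
Unset Strict Implicit.
Unset Printing Implicit Defensive.
Import Order.TTheory GRing.Theory Num.Theory.
Import numFieldNormedType.Exports.
Local Open Scope classical_set_scope.
Local Open Scope ring_scope.

Definition strictly_increasing_on (R : realType) (I : set R) (f : R -> R) : Prop :=
  {in I &, {homo f : x y / x < y}}.

Definition conv (R : realType) (S : set R) : set R := smallest (@is_interval R) S.

(* Functions on a subset of R are represented by total functions R -> R whose
   values outside that subset are irrelevant. *)
Definition is_generalized_inverse (R : realType) (I : set R) (f h : R -> R) : Prop :=
  [/\ set_fun (conv (f @` I)) I h,
      {in conv (f @` I) &, {homo h : x y / x <= y}} &
      {in I, forall x, h (f x) = x}].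

(* Well defined on conv (f @` I) when I is an interval and f is strictly
   increasing on I: see generalized_inverseP and generalized_inverse_unique. *)
Definition generalized_inverse (R : realType) (I : set R) (f : R -> R) : R -> R :=
  xget (fun=> 0) [set h | is_generalized_inverse I f h].

Definition qamean (R : realType) (I : set R) (f : R -> R) (n : nat)
    (x : n.-tuple R) : R :=
  generalized_inverse I f ((\sum_(i < n) f (tnth x i)) / n%:R).

Definition tuples_in (R : realType) (I : set R) (n : nat) : set (n.-tuple R) :=
  [set x | forall i, I (tnth x i)].

(* On a nonempty sequence these are the minimum and the maximum of its entries;
   the value on the empty sequence is junk. *)
Definition seq_min (R : realType) (s : seq R) : R :=
  \big[Num.min/head 0 s]_(x <- s) x.
Definition seq_max (R : realType) (s : seq R) : R :=
  \big[Num.max/head 0 s]_(x <- s) x.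

(* Below, a mean in n variables on I is a function M : n.-tuple R -> R, of which
   only the values on I^n matter. Where one variable is singled out,
   n is written m.+1 and (x, y_1, ..., y_(n-1)) is [tuple of x :: y] with
   y : m.-tuple R. *)
Definition internality_point (R : realType) (I : set R) (m : nat)
    (M : m.+1.-tuple R -> R) (x : R) : Prop :=
  I x /\
  forall y : m.-tuple R, tuples_in I y -> M [tuple of x :: y] = x ->
    (forall i, tnth y i = x) \/ seq_min y < x < seq_max y.

Definition internality_set (R : realType) (I : set R) (m : nat)
    (M : m.+1.-tuple R -> R) : set R :=
  [set x | internality_point I M x].

(* The tuple z is (x_1, ..., x_k, x_(k+1), ..., x_n). *)
Definition attracting (R : realType) (I : set R) (n : nat) (k : nat)
    (M : n.-tuple R -> R) (V : set R) : Prop :=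
  V `<=` I /\
  forall x : k.-tuple R, tuples_in V x ->
    exists z : n.-tuple R, [/\ tuples_in I z, take k z = x & V (M z)].

Definition passage_point (R : realType) (I : set R) (m : nat)
    (M : m.+1.-tuple R -> R) (t : R) : Prop :=
  I t /\
  exists y z : m.-tuple R,
    [/\ tuples_in I y,
        tuples_in I z,
        forall i, tnth y i = tnth z i \/
          (tnth y i < tnth z i /\
           `[tnth y i, tnth z i]%classic `<=` internality_set I M) &
        M [tuple of t :: y] < t < M [tuple of t :: z]].

Definition passable (R : realType) (I : set R) (m : nat)
    (M : m.+1.-tuple R -> R) : Prop :=
  forall t, I t -> passage_point I M t.

Lemma convP (R : realType) (S : set R) (y : R) :
  conv S y <-> exists a b, [/\ S a, S b & a <= y <= b].
Proof.
split=> [Sy|[a [b [Sa Sb ayb]]] A [iA SA]]; last exact: (iA a b (SA _ Sa) (SA _ Sb)).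
apply: (Sy [set y | exists a b, [/\ S a, S b & a <= y <= b]]); split.
  move=> u v [a [b [Sa Sb /andP[au ub]]]] [c [d [Sc Sd /andP[cv vd]]]] w /andP[uw wv].
  by exists a, d; split=> //; rewrite (le_trans au uw) (le_trans wv vd).
by move=> x Sx; exists x, x; rewrite lexx.
Qed.

Lemma generalized_inverseP (R : realType) (I : set R) (f : R -> R) :
  is_interval I -> strictly_increasing_on I f ->
  is_generalized_inverse I f (generalized_inverse I f).
Proof.
move=> iI fI; apply: (@xgetPex _ (fun=> 0) [set h | is_generalized_inverse I f h]).
have lef a b : I a -> I b -> f a <= f b -> a <= b.
  move=> Ia Ib; case: (leP a b) => // ba; rewrite leNgt => /negP[].
  by apply: fI ba; rewrite inE.
pose L y := [set x | I x /\ f x <= y].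
have ubL y b : I b -> y <= f b -> ubound (L y) b.
  by move=> Ib yb x [Ix fx]; apply: lef => //; apply: le_trans yb.
exists (fun y => sup (L y)); split=> /=.
- move=> y /convP[_ [_ [[a Ia <-] [b Ib <-] /andP[fay yfb]]]].
  apply: (iI a b) => //; apply/andP; split.
    by apply: ub_le_sup => //; exists b; apply: ubL.
  by apply: ge_sup; [exists a | apply: ubL].
- move=> y y'; rewrite !inE => /convP[_ [_ [[a Ia <-] _ /andP[fay _]]]].
  move=> /convP[_ [_ [_ [b Ib <-] /andP[_ yfb]]]] yy'.
  apply: ge_sup; first by exists a.
  move=> x [Ix fx]; apply: ub_le_sup; first by exists b; apply: ubL.
  by split=> //; apply: le_trans yy'.
- move=> x /set_mem Ix; apply/eqP; rewrite eq_le; apply/andP; split.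
    by apply: ge_sup; [exists x | apply: ubL].
  by apply: ub_le_sup => //; exists x; apply: ubL.
Qed.

Lemma generalized_inverse_unique (R : realType) (I : set R) (f h1 h2 : R -> R) :
  is_interval I ->
  is_generalized_inverse I f h1 -> is_generalized_inverse I f h2 ->
  {in conv (f @` I), h1 =1 h2}.
Proof.
move=> iI.
suff le12 k1 k2 : is_generalized_inverse I f k1 -> is_generalized_inverse I f k2 ->
    {in conv (f @` I), forall y, k1 y <= k2 y}.
  by move=> H1 H2 y yC; apply/eqP; rewrite eq_le !le12.
move=> [I1 m1 c1] [I2 m2 c2] y yC; rewrite leNgt; apply/negP => lt21.
have /set_mem yC' := yC.
pose x := (k2 y + k1 y) / 2.
have /andP[l2 l1] : k2 y < x < k1 y by rewrite !midf_lt.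
have Ix : I x by apply: (iI _ _ (I2 _ yC') (I1 _ yC')); rewrite !ltW.
have Cfx : f x \in conv (f @` I).
  by rewrite inE; apply/convP; exists (f x), (f x); rewrite lexx; split=> //; exists x.
have Ix' : x \in I by rewrite inE.
case: (leP (f x) y) => [fxy|/ltW yfx].
  by have := m2 _ _ Cfx yC fxy; rewrite c2 // leNgt l2.
by have := m1 _ _ yC Cfx yfx; rewrite c1 // leNgt l1.
Qed.

(* Main.v *)
Require Import Defs.
From mathcomp Require Import all_boot all_order all_algebra.
From mathcomp Require Import all_classical all_reals all_analysis.
From mathcomp Require Import ring lra.
Import Order.TTheory GRing.Theory Num.Theory.
Import numFieldNormedType.Exports.
Local Open Scope classical_set_scope.
Local Open Scope ring_scope.

(** Internality points of the mean are exactly the points where [f]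
   has no jump; they are therefore also the points where [g] has no jump, and they
   are dense. On the interior of this set the attracting property yields a Pexider
   equation for [g] composed with the inverse of [f], so [g] is locally affine in
   [f], with one slope [a] everywhere. Moving the variables along a passage through
   [t] shows that [g - a f] takes, near [t], one value at all points without a
   jump; hence [e := g - a f - K] vanishes at every such point for some constant [K],
   and the values of [e] at any variables with mean at such a point sum to 0.

   Suppose [e t <> 0]. If [u1, u2] are values of [f] at interior points, then
   [u1 + u2 - f t] is not a value of [f] at a point without a jump. This bounds the
   lengths [f q - f p] of the intervals [[p, q]] without jumps; let [ell] be their
   supremum, and m+1 the number of variables. An interval of values of length L that
   [f] avoids outside its jumps lies in the jump at one point [s], and a passage
   through [s], which moves at most m variables, gives (m+1) L <= m ell. Taking for it the
   translate by [u - f t] of an interval of nearly maximal length shows that all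
   interior points are on one side of [t], and that [f] is bounded on that side.
   Taking for it the means of [t] and of m values in a nearly maximal interval, the
   passage through [s] consists of nearly maximal intervals only, one of which lies
   strictly between [t] and the given one. Iterating contradicts the boundedness. *)

(** * Two tools on the real line: Cauchy's equation and connectedness *)

(** Subtracting the linear function with the same value at [d] leaves an additive [mu] with
    [mu d = 0]. Monotonicity bounds [mu] on [[0, d]], while each of its values there can be doubled
    within [[0, d]], so [mu] vanishes. *)
Lemma additive_mono_linear (R : realType) (phi : R -> R) (d : R) : 0 < d ->
  (forall s t, `|s| <= d -> `|t| <= d -> `|s + t| <= d ->
     phi (s + t) = phi s + phi t) ->
  (forall s t, - d <= s -> s <= t -> t <= d -> phi s <= phi t) ->
  exists a, forall s, `|s| <= d -> phi s = a * s.
Proof.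
move=> d0 phiD phi_le; pose mu s := phi s - phi d / d * s.
have muD s t : `|s| <= d -> `|t| <= d -> `|s + t| <= d -> mu (s + t) = mu s + mu t.
  by move=> hs ht hst; rewrite /mu phiD//; ring.
have mu_d : mu d = 0 by rewrite /mu divfK ?subrr// gt_eqF.
have mu_0 : mu 0 = 0.
  have := muD 0 0; rewrite addr0 normr0 => /(_ (ltW d0) (ltW d0) (ltW d0)).
  by lra.
have phi_0 : phi 0 = 0 by move: mu_0; rewrite /mu mulr0 subr0.
have small s : 0 <= s <= d -> `|s| <= d by move=> /andP[s0 sd]; rewrite ger0_norm.
have mu_double s : 0 <= s <= d -> exists2 r, 0 <= r <= d & mu r = 2 * mu s.
  move=> s0d; have [sd|ds] := leP (2 * s) d.
    exists (s + s); first by lra.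
    by rewrite muD ?small//; lra.
  (* Subtracting [d] brings the doubled argument back into [[0, d]] and costs nothing, since
     [mu d = 0]. *)
  exists (2 * s - d); first by lra.
  have e1 : mu (2 * s - d + (d - s)) = mu (2 * s - d) + mu (d - s).
    by apply: muD; apply: small; lra.
  have e2 : mu (s + (d - s)) = mu s + mu (d - s).
    by apply: muD; apply: small; lra.
  have e3 : 2 * s - d + (d - s) = s by ring.
  have e4 : s + (d - s) = d by ring.
  rewrite e3 in e1; rewrite e4 mu_d in e2; lra.
have bnd k s : 0 <= s <= d -> `|mu s| * 2 ^+ k <= phi d.
  elim: k s => [|k IH] s s0d.
    rewrite expr0 mulr1 ler_norml.
    have /andP[s0 sd] := s0d.
    have h1 : phi 0 <= phi s by apply: phi_le => //; lra.
    have h2 : phi s <= phi d by apply: phi_le => //; lra.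
    have d_pos : 0 <= phi d / d by apply: divr_ge0; lra.
    have h3 : 0 <= phi d / d * s by apply: mulr_ge0.
    have h4 : phi d / d * s <= phi d.
      by rewrite -[leRHS](divfK (lt0r_neq0 d0)); apply: ler_wpM2l.
    by rewrite /mu; lra.
  have [r r0d er] := mu_double s s0d.
  by have := IH r r0d; rewrite er normrM ger0_norm// exprS; lra.
have mu0 s : 0 <= s <= d -> mu s = 0.
  move=> s0d; apply/eqP; apply: contraT => nz.
  have pos : 0 < `|mu s| by rewrite normr_gt0.
  have := bnd (Num.truncn (phi d / `|mu s|)).+1 s s0d.
  rewrite -ler_pdivlMl// leNgt => /negP[].
  have lt2 : phi d / `|mu s| < (Num.truncn (phi d / `|mu s|)).+1%:R by exact: truncnS_gt.
  rewrite mulrC (lt_le_trans lt2)// -natrX ler_nat.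
  by apply: ltnW; apply: ltn_expl.
exists (phi d / d) => s hs; apply/eqP; rewrite -subr_eq0; apply/eqP.
rewrite -/(mu s); have [s0|s0] := leP 0 s.
  by apply: mu0; rewrite s0 -(ger0_norm s0).
have ns : 0 <= - s <= d by rewrite -(ltr0_norm s0) normr_ge0.
have := muD s (- s) hs; rewrite normrN subrr normr0 mu_0 (mu0 _ ns) => /(_ hs (ltW d0)).
lra.
Qed.

(** Connectedness of an interval: the supremum [c] of the points up to which [phi] keeps its value
    at [x] could be exceeded if it were less than [y]. *)
Lemma locally_constant (R : realType) (I : set R) (T : Type) (phi : R -> T) :
  is_interval I ->
  (forall x, I x -> exists2 d : R, 0 < d & forall y, I y -> `|y - x| < d -> phi y = phi x) ->
  forall x y, I x -> I y -> phi x = phi y.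
Proof.
move=> iI loc.
suff ltc x y : I x -> I y -> x <= y -> phi x = phi y.
  move=> x y Ix Iy; have [xy|/ltW yx] := leP x y; first exact: ltc.
  by apply/esym/ltc.
move=> Ix Iy xy.
pose S := [set u | x <= u <= y /\ forall v, x <= v <= u -> phi v = phi x].
have Sx : S x by split=> [|v ?]; [lra|congr phi; lra].
have ubS : ubound S y by move=> u [/andP[]].
have supS : has_sup S by split; [exists x|exists y].
pose c := sup S.
have xc : x <= c by apply: ub_le_sup => //; exists y.
have cy : c <= y by apply: ge_sup => //; exists x.
have Ic : I c by apply: (iI x y) => //; rewrite xc.
have [d d0 locd] := loc c Ic.
have [u [uxy Su] ucd] := sup_adherent d0 supS.
have uc : u <= c by apply: ub_le_sup => //; exists y.
have phic : phi c = phi x.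
  have /andP[xu _] := uxy.
  rewrite -(Su u) ?xu ?lexx//; apply/esym/locd; first by apply: (iI x y).
  by rewrite ltr_norml; rewrite -/c in ucd; lra.
have near_c v : x <= v <= y -> v < c + d -> phi v = phi x.
  move=> vxy vcd; have [vu|uv] := leP v u; first by apply: Su; lra.
  rewrite -phic; apply: locd; first exact: (iI x y).
  by rewrite ltr_norml; rewrite -/c in ucd; lra.
apply/esym/near_c; first by lra.
rewrite ltNge; apply/negP => cdy.
have : c + d / 2 <= c.
  apply: ub_le_sup; first by exists y.
  split=> [|v v_]; first by lra.
  by apply: near_c; lra.
lra.
Qed.

(* The fibre of the generalized inverse over [x] is the jump [[f(x-), f(x+)]] of [f]:
   it is [{f x}] exactly when [f] is continuous at [x]. *)
Definition no_jump {R : realType} (I : set R) (f h : R -> R) (x : R) : Prop :=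
  I x /\ forall v, Defs.conv (f @` I) v -> h v = x -> v = f x.

Definition no_jump_itv {R : realType} (I : set R) (f h : R -> R) (p q : R) : Prop :=
  p < q /\ forall x, p <= x <= q -> no_jump I f h x.

(* The variables of a mean are split as (t, w_0, ..., w_(m-1)). *)
Definition amean {R : realType} {m : nat} (F : R -> R) (t : R) (w : 'I_m -> R) : R :=
  (F t + \sum_(i < m) F (w i)) / m.+1%:R.

(** The conditions on the minimum and the maximum of [y] are replaced by the existence of entries on
    either side of [x]. *)
Definition internal {R : realType} (I : set R) {m : nat}
    (M : R -> ('I_m -> R) -> R) (x : R) : Prop :=
  I x /\ forall y, (forall i, I (y i)) -> M x y = x ->
    (forall i, y i = x) \/ (exists i, y i < x) /\ (exists i, x < y i).

Definition inner_no_jump {R : realType} (I : set R) (f h : R -> R) (x : R) : Prop :=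
  exists2 d : R, 0 < d & forall y, `|y - x| < d -> no_jump I f h y.

(** Internality points are replaced by points without a jump. The index type ['I_k.+1] of the moved
    variables encodes that there are at least two variables. *)
Definition passage {R : realType} (k : nat) (I : set R) (f h : R -> R) (t : R) : Prop :=
  exists y z : 'I_k.+1 -> R,
    [/\ forall i, I (y i), forall i, I (z i),
        forall i, y i = z i \/ no_jump_itv I f h (y i) (z i),
        h (amean f t y) < t & t < h (amean f t z)].

Definition pair_attracting {R : realType} (k : nat) (I : set R) (f h : R -> R) : Prop :=
  forall x1 x2, inner_no_jump I f h x1 -> inner_no_jump I f h x2 ->
  exists w : 'I_k.+1 -> R,
    [/\ w ord0 = x2, forall i, I (w i) & inner_no_jump I f h (h (amean f x1 w))].

(** * Identities for arithmetic means of function values *)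

Lemma amean_single {R : realType} (k : nat) (F : R -> R) (x y : R) :
  amean F x (fun i : 'I_k.+1 => if i == ord0 then y else x) =
  F x + (F y - F x) / k.+2%:R.
Proof.
rewrite /amean big_ord_recl/= (eq_bigr (fun=> F x))//.
rewrite sumr_const card_ord -mulr_natr -(natr1 k.+1) -(natr1 k).
have k0 : 0 <= k%:R :> R by rewrite ler0n.
by field; lra.
Qed.

(** Both functions and tuples vary, so that this covers the interpolation between two tuples as well
    as linear relations between [f], [g] and [e] on one tuple. *)
Lemma amean_lin {R : realType} {m : nat} (F G H : R -> R) (a b t u v : R)
    (w y z : 'I_m -> R) :
  F t = a * G u + b * H v -> (forall i, F (w i) = a * G (y i) + b * H (z i)) ->
  amean F t w = a * amean G u y + b * amean H v z.
Proof.
move=> eqt eqw; rewrite /amean eqt (eq_bigr _ (fun i _ => eqw i)) big_split/=.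
by rewrite -!mulr_sumr; ring.
Qed.

Definition upd0 {R : realType} {k : nat} (w : 'I_k.+1 -> R) (x : R) : 'I_k.+1 -> R :=
  fun i => if i == ord0 then x else w i.

Lemma amean_upd0 {R : realType} {k : nat} (F : R -> R) (t u x : R) (w : 'I_k.+1 -> R) :
  amean F u (upd0 w x) = amean F t w + (F u - F t + (F x - F (w ord0))) / k.+2%:R.
Proof. by rewrite /amean !big_ord_recl /upd0/=; ring. Qed.

Lemma amean_cst {R : realType} {m : nat} (F : R -> R) (t x : R) :
  amean F t (fun _ : 'I_m => x) = (F t + m%:R * F x) / m.+1%:R.
Proof. by rewrite /amean sumr_const card_ord mulr_natl. Qed.

(** * The generalized inverse and the jumps of an increasing function *)

Section GeneralizedInverse.
Context {R : realType} {I : set R} {f h : R -> R}.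
Hypotheses (iI : is_interval I) (fI : strictly_increasing_on I f).
Hypothesis hP : is_generalized_inverse I f h.
Local Notation J := (Defs.conv (f @` I)).

Lemma incr_lt x y : I x -> I y -> (f x < f y) = (x < y).
Proof.
move=> Ix Iy; have mono a b : I a -> I b -> a < b -> f a < f b.
  by move=> Ia Ib; apply: fI; rewrite inE.
have [xy|yx|->] := ltgtP x y; last by rewrite ltxx.
  by rewrite mono.
by apply/negbTE; rewrite -leNgt ltW// mono.
Qed.

Lemma incr_le x y : I x -> I y -> (f x <= f y) = (x <= y).
Proof. by move=> Ix Iy; rewrite !leNgt incr_lt. Qed.

Lemma conv_image x : I x -> J (f x).
Proof. by move=> Ix; apply/convP; exists (f x), (f x); rewrite lexx; split=> //; exists x. Qed.

Lemma conv_between a b v : J a -> J b -> a <= v <= b -> J v.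
Proof.
move=> /convP[a1 [_ [Sa1 _ /andP[a1a _]]]] /convP[_ [b2 [_ Sb2 /andP[_ bb2]]]].
move=> /andP[av vb]; apply/convP; exists a1, b2; split=> //.
by rewrite (le_trans a1a av) (le_trans vb bb2).
Qed.

Lemma ginv_in v : J v -> I (h v).
Proof. by case: hP => + _ _; apply. Qed.

Lemma ginvK x : I x -> h (f x) = x.
Proof. by move=> Ix; case: hP => _ _; apply; rewrite inE. Qed.

Lemma ginv_le v w : J v -> J w -> v <= w -> h v <= h w.
Proof. by move=> Jv Jw; case: hP => _ + _; apply; rewrite inE. Qed.

Lemma ginv_lt v w : J v -> J w -> h v < h w -> v < w.
Proof. by move=> Jv Jw; rewrite !ltNge; apply: contra; apply: ginv_le. Qed.

Lemma ginv_lel v x : J v -> I x -> v <= f x -> h v <= x.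
Proof.
move=> Jv Ix vx; rewrite -[leRHS]ginvK//; apply: ginv_le => //.
exact: conv_image.
Qed.

Lemma ginv_ler v x : J v -> I x -> f x <= v -> x <= h v.
Proof.
move=> Jv Ix xv; rewrite -[leLHS]ginvK//; apply: ginv_le => //.
exact: conv_image.
Qed.

Lemma ginv_ltl v x : J v -> I x -> h v < x -> v < f x.
Proof.
move=> Jv Ix hx; rewrite ltNge; apply/negP => /(ginv_ler _ _ Jv Ix).
by rewrite leNgt hx.
Qed.

Lemma ginv_ltr v x : J v -> I x -> x < h v -> f x < v.
Proof.
move=> Jv Ix hx; rewrite ltNge; apply/negP => /(ginv_lel _ _ Jv Ix).
by rewrite leNgt hx.
Qed.

(** An intermediate value theorem: monotonicity puts [h v] in [[p, q]], and a point there has only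
    one value in its fibre. *)
Lemma no_jump_itvP p q v : no_jump_itv I f h p q -> f p <= v <= f q ->
  [/\ J v, no_jump I f h (h v), p <= h v <= q & f (h v) = v].
Proof.
move=> [pq cpq] /andP[pv vq].
have [Ip _] : no_jump I f h p by apply: cpq; rewrite lexx ltW.
have [Iq _] : no_jump I f h q by apply: cpq; rewrite lexx ltW.
have Jv : J v by apply: (conv_between (f p) (f q)); rewrite ?pv//; apply: conv_image.
have hpq : p <= h v <= q by rewrite ginv_ler// ginv_lel.
have c := cpq _ hpq; split=> //; by case: c => _ /(_ v Jv erefl).
Qed.

Lemma no_jump_itv_in p q : no_jump_itv I f h p q -> I p /\ I q.
Proof.
by move=> [pq cpq]; split; [have [] := cpq p | have [] := cpq q] => //; rewrite lexx ltW.
Qed.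

(** The fibre over a jump is a nondegenerate interval and contains a rational, so the jumps are
    countably many; but []a, b[] has positive measure. *)
Lemma no_jump_dense a b : I a -> I b -> a < b ->
  exists2 c, a < c < b & no_jump I f h c.
Proof.
move=> Ia Ib ab; apply: contrapT => none.
have cnt : countable ((h \o ratr) @` [set: rat]).
  exact: (card_le_trans (card_image_le _ _) (countableP _)).
have sub : `]a, b[%classic `<=` (h \o ratr) @` [set: rat].
  move=> c /=; rewrite in_itv/= => acb.
  have Ic : I c by apply: (iI a b) => //; lra.
  have [v [Jv hv vc]] : exists v, [/\ J v, h v = c & v <> f c].
    apply: contrapT => nv; apply: none; exists c => //; split=> // v Jv hv.
    by apply: contrapT => vc; apply: nv; exists v.
  have Jc := conv_image _ Ic.
  have fill x y : J x -> J y -> h x = c -> h y = c -> x < y ->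
      exists2 r : rat, True & h (ratr r) = c.
    move=> Jx Jy hx hy xy; have [r] := rat_in_itvoo xy.
    rewrite in_itv/= => /andP[xr ry]; exists r => //.
    have Jr : J (ratr r) by apply: (conv_between x y) => //; rewrite !ltW.
    have := ginv_le _ _ Jx Jr (ltW xr); have := ginv_le _ _ Jr Jy (ltW ry).
    by rewrite hx hy => rc cr; apply/eqP; rewrite eq_le rc.
  have [vltc|cltv|//] := ltgtP v (f c).
    have [r _ hr] := fill v (f c) Jv Jc hv (ginvK _ Ic) vltc.
    by exists r.
  have [r _ hr] := fill (f c) v Jc Jv (ginvK _ Ic) hv cltv.
  by exists r.
have : (lebesgue_measure `]a, b[%classic = 0 :> \bar R)%E.
  apply: countable_lebesgue_measure0.
  by apply: sub_countable cnt; apply: subset_card_le.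
rewrite lebesgue_measure_itv/= lte_fin ab -EFinD => -[]; lra.
Qed.

(** Two different values of [h] would enclose a point without a jump, whose value would lie between
    [A] and [B]. Hence a gap in these values belongs to a single jump. *)
Lemma ginv_cst A B : J A -> J B ->
  (forall c, no_jump I f h c -> ~ A < f c < B) ->
  forall v w, A < v < B -> A < w < B -> h v = h w.
Proof.
move=> JA JB avoid.
suff hle v w : A < v < B -> A < w < B -> h v <= h w.
  by move=> v w hv hw; apply/eqP; rewrite eq_le !hle.
move=> vAB wAB; rewrite leNgt; apply/negP => wv.
have Jv : J v by apply: (conv_between A B) => //; lra.
have Jw : J w by apply: (conv_between A B) => //; lra.
have [c /andP[wc cv] cC] := no_jump_dense _ _ (ginv_in _ Jw) (ginv_in _ Jv) wv.
have [Ic _] := cC.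
have := ginv_ltl _ _ Jw Ic wc; have := ginv_ltr _ _ Jv Ic cv => ? ?.
by apply: (avoid c cC); lra.
Qed.

Section Mean.
Context {m : nat}.
Local Notation mean := (@amean R m f).

Lemma amean_conv t w : I t -> (forall i, I (w i)) -> J (mean t w).
Proof.
move=> It Iw; rewrite /amean.
have n0 : 0 < m.+1%:R :> R by rewrite ltr0n.
pose lo := \big[Num.min/f t]_(i < m) f (w i).
pose hi := \big[Num.max/f t]_(i < m) f (w i).
have Jlo : J lo.
  by rewrite /lo; elim/big_ind: _ => [|x y Jx Jy|i _];
    [exact: conv_image|rewrite /Num.min; case: ifP|exact: conv_image].
have Jhi : J hi.
  by rewrite /hi; elim/big_ind: _ => [|x y Jx Jy|i _];
    [exact: conv_image|rewrite /Num.max; case: ifP|exact: conv_image].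
have lot : lo <= f t by apply: bigmin_le_id.
have tho : f t <= hi by apply: bigmax_ge_id.
have low i : lo <= f (w i) by apply: bigmin_le_cond.
have hiw i : f (w i) <= hi by apply: le_bigmax_cond.
apply: (conv_between lo hi) => //; rewrite ler_pdivlMr// ler_pdivrMr//.
apply/andP; split.
  rewrite -natr1 mulrDr mulr1 addrC lerD//.
  by rewrite mulr_natr -[X in _ *+ X](card_ord m) -sumr_const ler_sum.
rewrite -natr1 mulrDr mulr1 addrC lerD//.
by rewrite mulr_natr -[X in _ *+ X](card_ord m) -sumr_const ler_sum.
Qed.

End Mean.
End GeneralizedInverse.

(** * Internality points are the points without a jump *)

Section Internality.
Context {R : realType} {I : set R} {f h : R -> R}.
Hypotheses (iI : is_interval I) (fI : strictly_increasing_on I f).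
Hypothesis hP : is_generalized_inverse I f h.
Context {k : nat}.

(** At a jump, replace one entry of the constant tuple [x] by a close point on the side of the jump:
    the mean of the values falls in the jump, so the mean is still [x]. Without a jump, a mean equal
    to [x] makes the differences [f (y i) - f x] sum to 0, so they have both signs or all vanish. *)
Lemma internalP x :
  internal I (fun t (w : 'I_k.+1 -> R) => h (amean f t w)) x <-> no_jump I f h x.
Proof.
have n0 : 0 < k.+2%:R :> R by rewrite ltr0n.
have n2 : 2 <= k.+2%:R :> R by rewrite ler_nat.
split=> -[Ix intx]; (split; first by []); [move=> v Jv hv|move=> y Iy hm].
  have [vx|xv|//] := ltgtP v (f x).
    pose S := [set f y | y in [set y | I y /\ y < x]].
    have ubv : ubound S v.
      by move=> _ [y [Iy yx] <-]; apply/ltW/(ginv_ltr hP) => //; rewrite hv.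
    have S0 : S !=set0.
      have /convP[_ [_ [[b Ib <-] _ /andP[bv _]]]] := Jv.
      exists (f b), b => //; split=> //; rewrite -(incr_lt fI)//; exact: le_lt_trans vx.
    have supS : has_sup S by split=> //; exists v.
    have sv : sup S <= v by apply: ge_sup.
    have d0 : 0 < f x - sup S by lra.
    have [_ [y [Iy yx] <-] fy] := sup_adherent d0 supS.
    pose w (i : 'I_k.+1) := if i == ord0 then y else x.
    have Iw i : I (w i) by rewrite /w; case: ifP.
    have Jm : Defs.conv (f @` I) (amean f x w) by exact: amean_conv.
    have [|w_x|[_ [i]]] := intx w Iw.
    - apply/eqP; rewrite eq_le; apply/andP; split.
        apply: (ginv_lel hP) => //; rewrite amean_single.
        have fyx : f y < f x by rewrite (incr_lt fI).
        by rewrite gerDl -oppr_ge0 -mulNr divr_ge0//; lra.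
      rewrite leNgt; apply/negP => hx.
      have Ih : I (h (amean f x w)) by apply: (ginv_in hP).
      set z := (h (amean f x w) + x) / 2.
      have Iz : I z by apply: (iI _ _ Ih Ix); rewrite /z; lra.
      have fz : amean f x w < f z.
        by apply: (ginv_ltl hP) => //; rewrite /z; lra.
      have : f z <= sup S.
        by apply: ub_le_sup; [exists v|exists z => //; split=> //; rewrite /z; lra].
      move: fz; rewrite amean_single.
      suff : (f x - f y) / k.+2%:R < f x - sup S
        by rewrite -(opprB (f y)) mulNr; set A := _ / _; lra.
      rewrite ltr_pdivrMr//.
      (* By the choice of [y], [f x - f y] is less than twice [f x - sup S]; dividing by the number
         of variables, at least 2, keeps the mean above [sup S]. *)
      have : (f x - sup S) * 2 <= (f x - sup S) * k.+2%:R by rewrite ler_pM2l.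
      lra.
    - by have := w_x ord0; rewrite /w eqxx; lra.
    - by rewrite /w; case: ifP; lra.
  pose S := [set f y | y in [set y | I y /\ x < y]].
  have lbv : lbound S v.
    by move=> _ [y [Iy yx] <-]; apply/ltW/(ginv_ltl hP) => //; rewrite hv.
  have S0 : S !=set0.
    have /convP[_ [_ [_ [b Ib <-] /andP[_ vb]]]] := Jv.
    exists (f b), b => //; split=> //; rewrite -(incr_lt fI)//; exact: lt_le_trans vb.
  have infS : has_inf S by split=> //; exists v.
  have sv : v <= inf S by apply: lb_le_inf.
  have d0 : 0 < inf S - f x by lra.
  have [_ [y [Iy yx] <-] fy] := inf_adherent d0 infS.
  pose w (i : 'I_k.+1) := if i == ord0 then y else x.
  have Iw i : I (w i) by rewrite /w; case: ifP.
  have Jm : Defs.conv (f @` I) (amean f x w) by exact: amean_conv.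
  have [|w_x|[[i wix] _]] := intx w Iw.
  - apply/eqP; rewrite eq_le; apply/andP; split; last first.
      apply: (ginv_ler hP) => //; rewrite amean_single.
      have fyx : f x < f y by rewrite (incr_lt fI).
      by rewrite lerDl divr_ge0//; lra.
    rewrite leNgt; apply/negP => hx.
    have Ih : I (h (amean f x w)) by apply: (ginv_in hP).
    set z := (h (amean f x w) + x) / 2.
    have Iz : I z by apply: (iI _ _ Ix Ih); rewrite /z; lra.
    have fz : f z < amean f x w.
      by apply: (ginv_ltr hP) => //; rewrite /z; lra.
    have : inf S <= f z.
      by apply: ge_inf; [exists v|exists z => //; split=> //; rewrite /z; lra].
    move: fz; rewrite amean_single.
    suff : (f y - f x) / k.+2%:R < inf S - f x by set A := _ / _; lra.
    rewrite ltr_pdivrMr//.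
    have : (inf S - f x) * 2 <= (inf S - f x) * k.+2%:R by rewrite ler_pM2l.
    lra.
  - by have := w_x ord0; rewrite /w eqxx; lra.
  - by move: wix; rewrite /w; case: ifP; lra.
have Jm : Defs.conv (f @` I) (amean f x y) by exact: amean_conv.
have sum0 : \sum_(i < k.+1) (f (y i) - f x) = 0.
  have := intx _ Jm hm; rewrite /amean => /(canRL (divfK (lt0r_neq0 n0))).
  rewrite sumrB sumr_const card_ord -mulr_natr -(natr1 k.+1) => /eqP.
  by rewrite mulrDr mulr1 addrC -subr_eq0 => /eqP e; rewrite -[RHS]e; ring.
have [all_x|/existsNP[i yix]] := pselect (forall i, y i = x); [by left|right].
apply: contrapT => /not_andP[] none.
  have ge0 j : 0 <= f (y j) - f x.
    rewrite subr_ge0 (incr_le fI)// leNgt; apply/negP => yjx.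
    by apply: none; exists j.
  have /psumr_eq0P-/(_ (fun j _ => ge0 j) i isT) := sum0.
  by move=> e; apply: yix; rewrite -(ginvK hP _ (Iy i)) -(ginvK hP _ Ix); congr h; lra.
have ge0 j : 0 <= f x - f (y j).
  rewrite subr_ge0 (incr_le fI)// leNgt; apply/negP => yjx.
  by apply: none; exists j.
have sum0' : \sum_(i < k.+1) (f x - f (y i)) = 0.
  rewrite (eq_bigr (fun i => - (f (y i) - f x))) => [|j _]; last by rewrite opprB.
  by rewrite sumrN sum0 oppr0.
have /psumr_eq0P-/(_ (fun j _ => ge0 j) i isT) := sum0'.
by move=> e; apply: yix; rewrite -(ginvK hP _ (Iy i)) -(ginvK hP _ Ix); congr h; lra.
Qed.

End Internality.

(** * Equal means: a common slope of [g] with respect to [f] *)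

Section EqualMeans.
Context {R : realType} {I : set R} {f g hf hg : R -> R} {k : nat}.
Hypotheses (iI : is_interval I) (fI : strictly_increasing_on I f).
Hypotheses (gI : strictly_increasing_on I g).
Hypotheses (fP : is_generalized_inverse I f hf) (gP : is_generalized_inverse I g hg).
Local Notation C := (no_jump I f hf).
Local Notation U := (inner_no_jump I f hf).
Hypothesis mean_eq : forall t (w : 'I_k.+1 -> R), I t -> (forall i, I (w i)) ->
  hf (amean f t w) = hg (amean g t w).
Hypothesis pass : forall t, I t -> passage k I f hf t.
Hypothesis attract : pair_attracting k I f hf.

Let n0 : 0 < k.+2%:R :> R. Proof. by rewrite ltr0n. Qed.

(** Internality depends on the mean alone, and the two means agree. *)
Lemma no_jump_eq x : C x <-> no_jump I g hg x.
Proof.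
rewrite -(internalP iI fI fP (k := k)) -(internalP iI gI gP (k := k)).
by split=> -[Ix intx]; (split; first by []) => y Iy hm; apply: intx => //;
  move: hm; rewrite mean_eq.
Qed.

Lemma inner_sub x : U x -> C x.
Proof. by move=> [d d0]; apply; rewrite subrr normr0. Qed.

Lemma mean_no_jump t (w : 'I_k.+1 -> R) : I t -> (forall i, I (w i)) -> C (hf (amean f t w)) ->
  f (hf (amean f t w)) = amean f t w /\ g (hf (amean f t w)) = amean g t w.
Proof.
move=> It Iw Ch; split.
  by have [_ /(_ _ (amean_conv _ _ It Iw) erefl)] := Ch.
have [_ cg] := (no_jump_eq _).1 Ch.
by apply/esym/cg; [exact: amean_conv|rewrite mean_eq].
Qed.

Lemma no_jump_itv_inner p q x : no_jump_itv I f hf p q -> p < x < q -> U x.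
Proof.
move=> [pq cpq] /andP[px xq]; exists (Num.min (x - p) (q - x)).
  by rewrite lt_min; lra.
by move=> y; rewrite lt_min !ltr_norml => ?; apply: cpq; lra.
Qed.

Lemma inner_no_jump_itv x : U x ->
  exists p q, [/\ no_jump_itv I f hf p q, p < x & x < q].
Proof.
move=> [d d0 cd]; exists (x - d / 2), (x + d / 2); split; [split| |]; try lra.
by move=> y ?; apply: cd; rewrite ltr_norml; lra.
Qed.

Lemma inner_values x : U x -> exists2 d : R, 0 < d & forall s, `|s| <= d ->
  [/\ Defs.conv (f @` I) (f x + s), C (hf (f x + s)) & f (hf (f x + s)) = f x + s].
Proof.
move=> /[dup] /inner_sub[Ix _] /inner_no_jump_itv[p [q [pq px xq]]].
have [Ip Iq] := no_jump_itv_in _ _ pq.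
exists (Num.min (f x - f p) (f q - f x)).
  by rewrite lt_min !subr_gt0 !(incr_lt fI) ?px.
move=> s; rewrite ler_norml => hs.
have [|? ? _ ?] := no_jump_itvP fP p q (f x + s) pq; last by split.
have m1 : Num.min (f x - f p) (f q - f x) <= f x - f p by rewrite ge_min lexx.
have m2 : Num.min (f x - f p) (f q - f x) <= f q - f x by rewrite ge_min lexx orbT.
lra.
Qed.

(* The values [f x1 + s1] and [f x2 + s2] enter the mean only through their sum,
   which is a Pexider equation for [g \o hf]. *)
Lemma common_local_slope x1 x2 : U x1 -> U x2 -> exists a d, 0 < d /\
  forall s, `|s| < d -> g (hf (f x1 + s)) = g x1 + a * s /\
                        g (hf (f x2 + s)) = g x2 + a * s.
Proof.
move=> U1 U2; have [w [w0 Iw Uq]] := attract _ _ U1 U2.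
have [[I1 _] [I2 _]] := (inner_sub _ U1, inner_sub _ U2).
have [d1 d1_0 v1] := inner_values _ U1.
have [d2 d2_0 v2] := inner_values _ U2.
have [d3 d3_0 v3] := inner_values _ Uq.
have [fq gq] := mean_no_jump _ _ I1 Iw (inner_sub _ Uq).
(* Halving leaves room for the sum of two increments. *)
pose d := Num.min d1 (Num.min d2 d3) / 2.
have d0 : 0 < d by rewrite divr_gt0// !lt_min d1_0 d2_0.
have dd1 : 2 * d <= d1 by rewrite mulrC divfK// ge_min lexx.
have dd2 : 2 * d <= d2 by rewrite mulrC divfK// !ge_min lexx orbT.
have dd3 : 2 * d <= d3 by rewrite mulrC divfK// !ge_min lexx !orbT.
pose G1 s := g (hf (f x1 + s)); pose G2 s := g (hf (f x2 + s)).
have G10 : G1 0 = g x1 by rewrite /G1 addr0 (ginvK fP).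
have G20 : G2 0 = g x2 by rewrite /G2 addr0 (ginvK fP).
pose q := hf (amean f x1 w).
have pexider s1 s2 : `|s1| <= d -> `|s2| <= d ->
    G1 s1 + G2 s2 - (g x1 + g x2) =
    k.+2%:R * (g (hf (f q + (s1 + s2) / k.+2%:R)) - amean g x1 w).
  move=> hs1 hs2.
  have [|J1 [Ih1 _] e1] := v1 s1; first by lra.
  have [|J2 [Ih2 _] e2] := v2 s2; first by lra.
  have hs : `|(s1 + s2) / k.+2%:R| <= d3.
    rewrite normf_div normr_nat ler_pdivrMr//.
    apply: le_trans (ler_normD _ _) _.
    have : d3 * 1 <= d3 * k.+2%:R by rewrite ler_pM2l// ler1n.
    lra.
  have [_ Cq' _] := v3 _ hs.
  pose x1' := hf (f x1 + s1); pose x2' := hf (f x2 + s2).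
  have Iw' i : I (upd0 w x2' i) by rewrite /upd0; case: ifP.
  have mf : amean f x1' (upd0 w x2') = f q + (s1 + s2) / k.+2%:R.
    by rewrite (amean_upd0 f x1) fq w0 e1 e2; ring.
  have := mean_no_jump x1' _ Ih1 Iw'; rewrite mf => /(_ Cq')[_ ->].
  rewrite (amean_upd0 g x1) w0 /G1 /G2 -/x1' -/x2'.
  have k0 : 0 <= k%:R :> R by [].
  by field; lra.
(* The right side of [pexider] depends on [s1 + s2] only; setting either increment to 0 shows that
   both functions grow alike, which leaves Cauchy's equation for one of them. *)
have lam_eq s : `|s| <= d -> G1 s - g x1 = G2 s - g x2.
  move=> hs; have := pexider s 0 hs; rewrite normr0 => /(_ (ltW d0)).
  have := pexider 0 s; rewrite normr0 => /(_ (ltW d0) hs).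
  by rewrite addr0 add0r G10 G20; lra.
have [a lam] : exists a, forall s, `|s| <= d -> G1 s - g x1 = a * s.
  apply: additive_mono_linear => // [s t hs ht hst|s t ds st td].
    have := pexider s t hs ht; have := pexider (s + t) 0 hst.
    rewrite normr0 => /(_ (ltW d0)); rewrite addr0 G20.
    by have := lam_eq t ht; lra.
  have [|J1 C1 e1] := v1 s; first by rewrite ler_norml; lra.
  have [|J2 C2 e2] := v1 t; first by rewrite ler_norml; lra.
  have [[Is _] [It _]] := (C1, C2).
  rewrite lerD2r /G1 (incr_le gI)//; apply: (ginv_le fP) => //.
  by rewrite lerD2l.
exists a, d; split=> // s /ltW hs.
by have := lam s hs; have := lam_eq s hs; rewrite /G1 /G2; lra.
Qed.

(** A passage must move some variable, and it does so along an interval without jumps. *)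
Lemma inner_exists x : I x -> exists y, U y.
Proof.
move=> /pass[y [z [Iy Iz yz lt gt]]].
have [i] : exists i, y i <> z i.
  apply: contrapT => none; have := lt_trans lt gt.
  suff -> : y = z by rewrite ltxx.
  apply/funext => i; apply: contrapT => ne; apply: none; by exists i.
have [//|yzi _] := yz i.
by exists ((y i + z i) / 2); apply: (no_jump_itv_inner (y i) (z i)) => //; have [] := yzi; lra.
Qed.

(** A fixed inner point [p] is paired with itself and with every other [x]; the two slopes obtained
    at [p] must agree. *)
Lemma common_slope x0 : I x0 -> exists2 a, 0 < a & forall x, U x ->
  exists2 d : R, 0 < d & forall s, `|s| < d -> g (hf (f x + s)) = g x + a * s.
Proof.
move=> /inner_exists[p Up].
have [a [d [d0 ad]]] := common_local_slope p p Up Up.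
have [r r0 vr] := inner_values _ Up.
have [Ip _] := inner_sub _ Up.
exists a.
  pose s := Num.min d r / 2.
  have s0 : 0 < s by rewrite divr_gt0// lt_min d0.
  have sd : 2 * s <= d by rewrite mulrC divfK// ge_min lexx.
  have sr : 2 * s <= r by rewrite mulrC divfK// ge_min lexx orbT.
  have [|Js [Ihs _] es] := vr s; first by rewrite ger0_norm; lra.
  have [|eg _] := ad s; first by rewrite ger0_norm; lra.
  have : p < hf (f p + s) by rewrite -(incr_lt fI)// es; lra.
  rewrite -(incr_lt gI)// eg ltrDl pmulr_lgt0//.
move=> x Ux.
have [b [d' [d'0 bd]]] := common_local_slope p x Up Ux.
suff <- : b = a by exists d' => // s /bd[].
pose s := Num.min d d' / 2.
have s0 : 0 < s by rewrite divr_gt0// lt_min d0.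
have sd : 2 * s <= d by rewrite mulrC divfK// ge_min lexx.
have sr : 2 * s <= d' by rewrite mulrC divfK// ge_min lexx orbT.
have [|e1 _] := ad s; first by rewrite ger0_norm; lra.
have [|e2 _] := bd s; first by rewrite ger0_norm; lra.
by apply: (mulIf (lt0r_neq0 s0)); lra.
Qed.

(** * From local slopes to one affine relation at all points without a jump *)

Context {a : R}.
Hypotheses (a0 : 0 < a).
Hypothesis slope : forall x, U x ->
  exists2 d : R, 0 < d & forall s, `|s| < d -> g (hf (f x + s)) = g x + a * s.

(** Local constancy of [g - a f] settles the open interval. At the endpoints one wrong inequality
    would make [g] jump, the other would contradict its monotonicity. *)
Lemma affine_on_itv p q x : no_jump_itv I f hf p q -> p <= x <= q ->
  g x - a * f x = g p - a * f p.
Proof.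
move=> pq; have [Ip Iq] := no_jump_itv_in _ _ pq.
have [plq cpq] := pq.
have open_cst v w : f p < v < f q -> f p < w < f q ->
    g (hf v) - a * v = g (hf w) - a * w.
  apply: (@locally_constant _ [set v | f p < v < f q] _ (fun v => g (hf v) - a * v)).
    by move=> u1 u2 /= ? ? z ?; lra.
  move=> u /= hu; have [|_ [Ihu _] _ e] := no_jump_itvP fP p q u pq; first by lra.
  have Uu : U (hf u).
    by apply: (no_jump_itv_inner p q) => //; rewrite -(incr_lt fI p)// -(incr_lt fI _ q)// e.
  have [d d0 sd] := slope _ Uu; exists d => // y _ /sd.
  by rewrite e addrC subrK => ->; ring.
have [K open_eq] : exists K, forall x, p < x < q -> g x = K + a * f x.
  have fpq : f p < f q by rewrite (incr_lt fI).
  exists (g (hf ((f p + f q) / 2)) - a * ((f p + f q) / 2)) => y pyq.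
  have [Iy _] : C y by apply: cpq; lra.
  rewrite -(open_cst (f y)) ?(ginvK fP)//; [ring| |lra].
  by rewrite !(incr_lt fI).
have in_I y : p < y < q -> I y by move=> ?; apply: (iI p q) => //; lra.
have eq_p : g p = K + a * f p.
  have [gpK|Kgp|//] := ltgtP (g p) (K + a * f p); exfalso.
    (* A value strictly inside the jump that [g] would have at [p]. *)
    pose w := (g p + (K + a * f p)) / 2.
    have above y : p < y < q -> w < g y.
      move=> pyq; rewrite open_eq//.
      have : a * f p < a * f y by rewrite ltr_pM2l// (incr_lt fI)//; [lra|exact: in_I].
      by rewrite /w; lra.
    have Jw : Defs.conv (g @` I) w.
      have pmq : p < (p + q) / 2 < q by lra.
      apply: (conv_between (g p) (g ((p + q) / 2))).
      - exact: conv_image.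
      - by apply: conv_image; apply: in_I; lra.
      by have := above _ pmq; rewrite /w; lra.
    have Cp : C p by apply: cpq; lra.
    have [_ /(_ w Jw) c] := (no_jump_eq p).1 Cp.
    suff /c : hg w = p by rewrite /w; lra.
    apply/eqP; rewrite eq_le; apply/andP; split; last first.
      by apply: (ginv_ler gP) => //; rewrite /w; lra.
    rewrite leNgt; apply/negP => pw.
    pose y := (p + Num.min (hg w) q) / 2.
    have pm : p < Num.min (hg w) q by rewrite lt_min pw.
    have m1 : Num.min (hg w) q <= hg w by rewrite ge_min lexx.
    have m2 : Num.min (hg w) q <= q by rewrite ge_min lexx orbT.
    have pyq : p < y < q by rewrite /y; lra.
    have : g y < w by apply: (ginv_ltr gP) => //; [exact: in_I|rewrite /y; lra].
    by have := above y pyq; lra.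
  pose e := g p - (K + a * f p).
  (* The increment [e / a] is what the affine formula needs to climb from [K + a * f p] to [g p];
     any smaller one gives [g (hf v) <= g p]. *)
  pose v := f p + Num.min ((f q - f p) / 2) (e / a).
  have fpq : f p < f q by rewrite (incr_lt fI).
  have m0 : 0 < Num.min ((f q - f p) / 2) (e / a).
    by rewrite lt_min !divr_gt0//; rewrite /e; lra.
  have m1 : Num.min ((f q - f p) / 2) (e / a) <= (f q - f p) / 2 by rewrite ge_min lexx.
  have m2 : a * Num.min ((f q - f p) / 2) (e / a) <= e.
    by rewrite mulrC -ler_pdivlMr// ge_min lexx orbT.
  have [|_ [Ihv _] _ ev] := no_jump_itvP fP p q v pq; first by rewrite /v; lra.
  have pvq : p < hf v < q by rewrite -(incr_lt fI p)// -(incr_lt fI _ q)// ev /v; lra.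
  have : g p < g (hf v) by rewrite (incr_lt gI)//; lra.
  rewrite (open_eq (hf v))// ev /v mulrDr; rewrite /e in m2 *; lra.
have eq_q : g q = K + a * f q.
  have [Kgq|gqK|//] := ltgtP (K + a * f q) (g q); exfalso.
    pose w := (g q + (K + a * f q)) / 2.
    have below y : p < y < q -> g y < w.
      move=> pyq; rewrite open_eq//.
      have : a * f y < a * f q by rewrite ltr_pM2l// (incr_lt fI)//; [lra|exact: in_I].
      by rewrite /w; lra.
    have Jw : Defs.conv (g @` I) w.
      have pmq : p < (p + q) / 2 < q by lra.
      apply: (conv_between (g ((p + q) / 2)) (g q)).
      - by apply: conv_image; apply: in_I; lra.
      - exact: conv_image.
      by have := below _ pmq; rewrite /w; lra.
    have Cq : C q by apply: cpq; lra.
    have [_ /(_ w Jw) c] := (no_jump_eq q).1 Cq.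
    suff /c : hg w = q by rewrite /w; lra.
    apply/eqP; rewrite eq_le; apply/andP; split.
      by apply: (ginv_lel gP) => //; rewrite /w; lra.
    rewrite leNgt; apply/negP => qw.
    pose y := (q + Num.max (hg w) p) / 2.
    have pm : Num.max (hg w) p < q by rewrite gt_max qw.
    have m1 : hg w <= Num.max (hg w) p by rewrite le_max lexx.
    have m2 : p <= Num.max (hg w) p by rewrite le_max lexx orbT.
    have pyq : p < y < q by rewrite /y; lra.
    have : w < g y by apply: (ginv_ltl gP) => //; [exact: in_I|rewrite /y; lra].
    by have := below y pyq; lra.
  pose e := (K + a * f q) - g q.
  pose v := f q - Num.min ((f q - f p) / 2) (e / a).
  have fpq : f p < f q by rewrite (incr_lt fI).
  have m0 : 0 < Num.min ((f q - f p) / 2) (e / a).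
    by rewrite lt_min !divr_gt0//; rewrite /e; lra.
  have m1 : Num.min ((f q - f p) / 2) (e / a) <= (f q - f p) / 2 by rewrite ge_min lexx.
  have m2 : a * Num.min ((f q - f p) / 2) (e / a) <= e.
    by rewrite mulrC -ler_pdivlMr// ge_min lexx orbT.
  have [|_ [Ihv _] _ ev] := no_jump_itvP fP p q v pq; first by rewrite /v; lra.
  have pvq : p < hf v < q by rewrite -(incr_lt fI p)// -(incr_lt fI _ q)// ev /v; lra.
  have : g (hf v) < g q by rewrite (incr_lt gI)//; lra.
  rewrite (open_eq (hf v))// ev /v mulrBr; rewrite /e in m2 *; lra.
move=> /andP[]; rewrite le_eqVlt => /predU1P[<- //|px].
rewrite le_eqVlt => /predU1P[->|xq]; first by lra.
by rewrite open_eq ?px//; lra.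
Qed.

(** Interpolate linearly between the values of [f] at [y] and at [z]. Each moved variable stays
    where [g] has slope [a], so the mean of the [g] values is affine in the mean [v] of the [f]
    values; [t] stays fixed. *)
Lemma passage_values t (y z : 'I_k.+1 -> R) v : I t ->
  (forall i, I (y i)) -> (forall i, I (z i)) ->
  (forall i, y i = z i \/ no_jump_itv I f hf (y i) (z i)) ->
  amean f t y < amean f t z -> amean f t y <= v <= amean f t z ->
  Defs.conv (g @` I) (a * v + (amean g t y - a * amean f t y)) /\
  hf v = hg (a * v + (amean g t y - a * amean f t y)).
Proof.
move=> It Iy Iz yz yltz hv.
pose s := (v - amean f t y) / (amean f t z - amean f t y).
have s01 : 0 <= s <= 1.
  by rewrite divr_ge0 ?ler_pdivrMr ?mul1r//=; lra.
have sE : s * (amean f t z - amean f t y) = v - amean f t y.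
  by rewrite /s -mulrA mulVf ?mulr1// subr_eq0 gt_eqF.
pose w i := hf ((1 - s) * f (y i) + s * f (z i)).
have wP i : [/\ I (w i), f (w i) = (1 - s) * f (y i) + s * f (z i)
               & g (w i) = a * f (w i) + 1 * (g (y i) - a * f (y i))].
  have [yzi|yzi] := yz i.
    have -> : w i = y i by rewrite /w -yzi -mulrDl subrK mul1r (ginvK fP).
    by split=> //; [rewrite -yzi|]; ring.
  have fyz : f (y i) < f (z i) by rewrite (incr_lt fI)//; have [] := yzi.
  have m1 : 0 <= s * (f (z i) - f (y i)) by apply: mulr_ge0; lra.
  have m2 : 0 <= (1 - s) * (f (z i) - f (y i)) by apply: mulr_ge0; lra.
  have [|_ [Ih _] bet e] := no_jump_itvP fP _ _ ((1 - s) * f (y i) + s * f (z i)) yzi.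
    by lra.
  split=> //; rewrite -/(w i) in bet; have := affine_on_itv _ _ _ yzi bet; lra.
have Iw i : I (w i) by have [] := wP i.
have fw : amean f t w = v.
  rewrite (@amean_lin _ _ f f f (1 - s) s t t t w y z); last by move=> i; have [] := wP i.
    by clearbody s; lra.
  by ring.
have gw : amean g t w = a * v + (amean g t y - a * amean f t y).
  rewrite (@amean_lin _ _ g f (fun x => g x - a * f x) a 1 t t t w w y).
  - rewrite fw (@amean_lin _ _ (fun x => g x - a * f x) g f 1 (- a) t t t y y y).
    + ring.
    + ring.
    + by move=> i; ring.
  - by ring.
  - by move=> i; have [] := wP i.
by rewrite -gw -mean_eq// fw; split=> //; exact: amean_conv.
Qed.

Lemma affine_near t : I t -> exists K lo hi,
  [/\ I lo, I hi, lo < t < hi & forall c, C c -> lo < c < hi -> g c = a * f c + K].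
Proof.
move=> It; have [y [z [Iy Iz yz lt gt]]] := pass _ It.
have Jy : Defs.conv (f @` I) (amean f t y) by exact: amean_conv.
have Jz : Defs.conv (f @` I) (amean f t z) by exact: amean_conv.
have yltz : amean f t y < amean f t z by apply: (ginv_lt fP) => //; apply: lt_trans gt.
exists (amean g t y - a * amean f t y), (hf (amean f t y)), (hf (amean f t z)).
split; [exact: (ginv_in fP)|exact: (ginv_in fP)|by rewrite lt|].
move=> c cC /andP[yc cz]; have [Ic _] := cC.
have ? := ginv_ltl fP _ _ Jy Ic yc; have ? := ginv_ltr fP _ _ Jz Ic cz.
have [|Jv e] := passage_values t y z (f c) It Iy Iz yz yltz; first by lra.
have [_ /(_ _ Jv)] := (no_jump_eq c).1 cC.
by rewrite -e (ginvK fP)// => ->.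
Qed.

(** The constants of two overlapping neighbourhoods agree at a common point without a jump, which
    exists by density; so the constant is locally constant in [t]. *)
Lemma affine_on_no_jump t0 : I t0 -> exists K, forall c, C c -> g c = a * f c + K.
Proof.
move=> It0.
have /choice[K KP] t : exists K, I t -> exists lo hi,
    [/\ I lo, I hi, lo < t < hi & forall c, C c -> lo < c < hi -> g c = a * f c + K].
  have [It|nIt] := pselect (I t); last by exists 0.
  by have [K ?] := affine_near t It; exists K.
exists (K t0) => c cC; have [Ic _] := cC.
rewrite -(@locally_constant _ I _ K iI _ c t0)//.
  by have [lo [hi [_ _ lch eqc]]] := KP c Ic; exact: eqc.
move=> x Ix; have [lo [hi [Ilo Ihi lxh eqx]]] := KP x Ix.
exists (Num.min (x - lo) (hi - x)); first by rewrite lt_min; lra.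
move=> y Iy; rewrite lt_min !ltr_norml => yx.
have [lo' [hi' [Ilo' Ihi' lyh eqy]]] := KP y Iy.
have [|||d dlh dC] := no_jump_dense iI fP (Num.max lo lo') (Num.min hi hi').
- by rewrite /Num.max; case: ifP.
- by rewrite /Num.min; case: ifP.
- by rewrite gt_max !lt_min; lra.
move: dlh; rewrite gt_max lt_min => dlh.
have := eqx d dC; have := eqy d dC.
by move=> e1 e2; have := e1 _; have := e2 _; lra.
Qed.

End EqualMeans.

(** * A contradiction from a nonzero defect [e t] *)

Section Defect.
Context {R : realType} {I : set R} {f hf e : R -> R} {k : nat} {t : R}.
Hypotheses (iI : is_interval I) (fI : strictly_increasing_on I f).
Hypotheses (fP : is_generalized_inverse I f hf).
Local Notation C := (no_jump I f hf).
Local Notation U := (inner_no_jump I f hf).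
Local Notation J := (Defs.conv (f @` I)).
Local Notation M := (k.+1%:R : R).
Hypothesis pass : forall t, I t -> passage k I f hf t.
Hypothesis attract : pair_attracting k I f hf.
Hypothesis eC : forall x, C x -> e x = 0.
Hypothesis mean_e : forall x (w : 'I_k.+1 -> R), I x -> (forall i, I (w i)) ->
  C (hf (amean f x w)) -> amean e x w = 0.
Hypotheses (It : I t) (et : e t <> 0).

Let n0 : 0 < k.+2%:R :> R. Proof. by rewrite ltr0n. Qed.
Let nM : k.+2%:R = M + 1. Proof. by rewrite -natr1. Qed.
Let M1 : 1 <= M. Proof. by rewrite ler1n. Qed.

Lemma jump_t : ~ C t. Proof. by move=> /eC. Qed.

Lemma itv_value p q v : no_jump_itv I f hf p q -> f p < v < f q ->
  [/\ C (hf v), U (hf v) & f (hf v) = v].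
Proof.
move=> pq hv; have [Ip Iq] := no_jump_itv_in _ _ pq.
have [|_ Ch _ ev] := no_jump_itvP fP p q v pq; first by lra.
have [Ih _] := Ch; split=> //; apply: (no_jump_itv_inner p q) => //.
by rewrite -(incr_lt fI p)// -(incr_lt fI _ q)// ev.
Qed.

Lemma itv_mid p q : no_jump_itv I f hf p q -> U ((p + q) / 2).
Proof. by move=> pq; apply: (no_jump_itv_inner p q) => //; have [] := pq; lra. Qed.

(* Replacing the first two entries [p1, p2] of an attracting tuple by [t, x]
   would keep its mean but change the sum of [e]. *)
Lemma sum_avoid p1 p2 x : U p1 -> U p2 -> C x -> f x + f t <> f p1 + f p2.
Proof.
move=> U1 U2 Cx eqs; have [w [w0 Iw Uq]] := attract _ _ U1 U2.
have [C1 C2] := (inner_sub _ U1, inner_sub _ U2).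
have [[I1 _] [Ix _]] := (C1, Cx).
have Cq := inner_sub _ Uq.
have Iw' i : I (upd0 w x i) by rewrite /upd0; case: ifP.
have same : amean f t (upd0 w x) = amean f p1 w.
  rewrite (amean_upd0 f p1) w0.
  have -> : f t - f p1 + (f x - f p2) = 0 by lra.
  by rewrite mul0r addr0.
have := mean_e t _ It Iw'; rewrite same => /(_ Cq).
rewrite (amean_upd0 e p1) w0 (mean_e _ _ I1 Iw Cq) (eC _ C1) (eC _ C2) (eC _ Cx).
rewrite !subr0 addr0 add0r => /eqP; rewrite mulf_eq0 invr_eq0 (gt_eqF n0) orbF.
by move=> /eqP.
Qed.

(** An interval of values longer than [f p0 - f t] in absolute value contains two values with that
    difference, placed symmetrically about its midpoint; this is what [sum_avoid] forbids. *)
Lemma len_bound p q p0 : no_jump_itv I f hf p q -> U p0 ->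
  f q - f p <= `|f p0 - f t|.
Proof.
move=> pq U0; rewrite leNgt; apply/negP; rewrite ltr_norml => hd.
set d := f p0 - f t in hd.
have [|_ Uu eu] := itv_value p q ((f p + f q) / 2 - d / 2) pq; first by lra.
have [|Cx _ ex] := itv_value p q ((f p + f q) / 2 + d / 2) pq; first by lra.
by apply: (sum_avoid _ _ _ Uu U0 Cx); rewrite eu ex /d; lra.
Qed.

Definition max_len := sup [set l | exists p q, no_jump_itv I f hf p q /\ l = f q - f p].
Local Notation ell := max_len.

Lemma itv_exists : exists p q, no_jump_itv I f hf p q.
Proof.
have [y [z [Iy Iz yz lt gt]]] := pass _ It.
apply: contrapT => none; have := lt_trans lt gt.
suff -> : y = z by rewrite ltxx.
by apply/funext => i; have [//|yzi] := yz i; case: none; exists (y i), (z i).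
Qed.

Lemma has_sup_len : has_sup [set l | exists p q, no_jump_itv I f hf p q /\ l = f q - f p].
Proof.
have [p [q pq]] := itv_exists.
split; first by exists (f q - f p), p, q.
exists `|f ((p + q) / 2) - f t| => _ [p1 [q1 [pq1 ->]]].
by apply: len_bound => //; apply: itv_mid.
Qed.

Lemma len_le p q : no_jump_itv I f hf p q -> f q - f p <= ell.
Proof.
by move=> pq; apply: ub_le_sup; [have [] := has_sup_len|exists p, q].
Qed.

Lemma max_len_gt0 : 0 < ell.
Proof.
have [p [q pq]] := itv_exists; apply: lt_le_trans (len_le p q pq).
by have [Ip Iq] := no_jump_itv_in _ _ pq; rewrite subr_gt0 (incr_lt fI)//; have [] := pq.
Qed.

Lemma len_near d : 0 < d -> exists p q,
  no_jump_itv I f hf p q /\ ell - (f q - f p) <= d.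
Proof.
move=> d0; have [_ [p [q [pq ->]]] hd] := sup_adherent d0 has_sup_len.
by exists p, q; split=> //; rewrite /max_len; lra.
Qed.

(** Between [A] and [B] the inverse is constantly [s], so the two means of a passage through [s]
    must lie on opposite sides of the gap. *)
Lemma passage_gap A B : J A -> J B -> A < B ->
  (forall c, C c -> ~ A < f c < B) -> exists s (y z : 'I_k.+1 -> R),
  [/\ s = hf ((A + B) / 2), I s, ~ C s,
      [/\ forall i, I (y i), forall i, I (z i),
          forall i, y i = z i \/ no_jump_itv I f hf (y i) (z i),
          amean f s y < f s & f s < amean f s z]
    & k.+2%:R * (B - A) <= \sum_(i < k.+1) (f (z i) - f (y i))].
Proof.
move=> JA JB AB avoid; pose v := (A + B) / 2.
have Jv : J v by apply: (conv_between A B) => //; rewrite /v; lra.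
have Is : I (hf v) by apply: (ginv_in fP).
have vAB : A < v < B by rewrite /v; lra.
have cst u : A < u < B -> hf u = hf v by move=> uAB; apply: (ginv_cst iI fP A B).
have [y [z [Iy Iz yz lt gt]]] := pass _ Is.
have Jy : J (amean f (hf v) y) by exact: amean_conv.
have Jz : J (amean f (hf v) z) by exact: amean_conv.
have yA : amean f (hf v) y <= A.
  rewrite leNgt; apply/negP => Ay.
  pose u := (A + Num.min (amean f (hf v) y) B) / 2.
  have m0 : A < Num.min (amean f (hf v) y) B by rewrite lt_min Ay.
  have m1 : Num.min (amean f (hf v) y) B <= B by rewrite ge_min lexx orbT.
  have m2 : Num.min (amean f (hf v) y) B <= amean f (hf v) y by rewrite ge_min lexx.
  have uAB : A < u < B by rewrite /u; lra.
  have Ju : J u by apply: (conv_between A B) => //; lra.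
  have : hf u <= hf (amean f (hf v) y) by apply: (ginv_le fP) => //; rewrite /u; lra.
  by rewrite (cst u)//; lra.
have Bz : B <= amean f (hf v) z.
  rewrite leNgt; apply/negP => zB.
  pose u := (B + Num.max (amean f (hf v) z) A) / 2.
  have m0 : Num.max (amean f (hf v) z) A < B by rewrite gt_max zB.
  have m1 : A <= Num.max (amean f (hf v) z) A by rewrite le_max lexx orbT.
  have m2 : amean f (hf v) z <= Num.max (amean f (hf v) z) A by rewrite le_max lexx.
  have uAB : A < u < B by rewrite /u; lra.
  have Ju : J u by apply: (conv_between A B) => //; lra.
  have : hf (amean f (hf v) z) <= hf u by apply: (ginv_le fP) => //; rewrite /u; lra.
  by rewrite (cst u)//; lra.
exists (hf v), y, z; split=> //.
- by move=> Cs; apply: (avoid _ Cs); have [_ /(_ v Jv erefl) <-] := Cs.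
- by split=> //; [apply: (ginv_ltl fP)|apply: (ginv_ltr fP)].
rewrite sumrB; move: yA Bz; rewrite /amean ler_pdivrMr// ler_pdivlMr//; lra.
Qed.

Lemma len_sum_le (y z : 'I_k.+1 -> R) :
  (forall i, y i = z i \/ no_jump_itv I f hf (y i) (z i)) ->
  forall i, f (z i) - f (y i) <= ell.
Proof.
move=> yz i; have [->|] := yz i; last exact: len_le.
by rewrite subrr ltW// max_len_gt0.
Qed.

(** The threshold beyond which a gap of this length admits no passage: only [M] of the [M + 1]
    variables move, each by at most [ell]. *)
Definition long p q := no_jump_itv I f hf p q /\ M * ell < (M + 1) * (f q - f p).

(** By [sum_avoid], the translate of the interval of values is a gap, too long for [passage_gap]. *)
Lemma no_shift p q p0 : long p q -> U p0 ->
  J (f p + (f p0 - f t)) -> J (f q + (f p0 - f t)) -> False.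
Proof.
move=> [pq big] U0 JA JB; have [Ip Iq] := no_jump_itv_in _ _ pq.
have fpq : f p < f q by rewrite (incr_lt fI)//; have [] := pq.
have [||s [y [z [_ _ _ [_ _ yz _ _]]]]] := passage_gap _ _ JA JB; first by lra.
  move=> c Cc hc.
  have [|_ Uu eu] := itv_value p q (f c - (f p0 - f t)) pq; first by lra.
  by apply: (sum_avoid _ _ _ Uu U0 Cc); rewrite eu; lra.
have : \sum_(i < k.+1) (f (z i) - f (y i)) <= \sum_(i < k.+1) ell.
  by apply: ler_sum => i _; apply: len_sum_le.
rewrite sumr_const card_ord -mulr_natl nM.
have -> : f q + (f p0 - f t) - (f p + (f p0 - f t)) = f q - f p by ring.
lra.
Qed.

(** If [p0 < t < p], the translated values lie between [f p0] and [f q], against [no_shift]. *)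
Lemma same_side_gt p q p0 : long p q -> U p0 -> t < p -> t < p0.
Proof.
move=> lpq U0 tp; have [Ip0 _] := inner_sub _ U0.
have [Ip Iq] := no_jump_itv_in _ _ lpq.1.
have [p0t|//|p0t] := ltgtP p0 t; last first.
  by case: jump_t; rewrite -p0t; apply: inner_sub.
have [pq _] := lpq.1.
have h1 : f p0 < f t by rewrite (incr_lt fI).
have h2 : f t < f p by rewrite (incr_lt fI).
have h3 : f p < f q by rewrite (incr_lt fI).
case: (no_shift p q p0 lpq U0).
- apply: (conv_between (f p0) (f p)); [exact: conv_image|exact: conv_image|lra].
- apply: (conv_between (f p0) (f q)); [exact: conv_image|exact: conv_image|lra].
Qed.

Lemma same_side_lt p q p0 : long p q -> U p0 -> q < t -> p0 < t.
Proof.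
move=> lpq U0 qt; have [Ip0 _] := inner_sub _ U0.
have [Ip Iq] := no_jump_itv_in _ _ lpq.1.
have [//|tp0|p0t] := ltgtP p0 t; last first.
  by case: jump_t; rewrite -p0t; apply: inner_sub.
have [pq _] := lpq.1.
have h1 : f t < f p0 by rewrite (incr_lt fI).
have h2 : f q < f t by rewrite (incr_lt fI).
have h3 : f p < f q by rewrite (incr_lt fI).
case: (no_shift p q p0 lpq U0).
- apply: (conv_between (f p) (f p0)); [exact: conv_image|exact: conv_image|lra].
- apply: (conv_between (f q) (f p0)); [exact: conv_image|exact: conv_image|lra].
Qed.

Lemma side_t p q : no_jump_itv I f hf p q -> t < p \/ q < t.
Proof.
move=> [pq cpq]; have [pt|] := leP p t; last by left.
have [tq|] := leP t q; last by right.
by case: jump_t; apply: cpq; rewrite pt.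
Qed.

(** Otherwise [f c] is the mean of [f t] and [M] copies of a value taken without a jump, and the sum
    of [e] over this tuple is [e t], not 0. *)
Lemma mean_t_avoid p q c : no_jump_itv I f hf p q -> C c ->
  ~ (f t + M * f p) / k.+2%:R < f c < (f t + M * f q) / k.+2%:R.
Proof.
move=> pq Cc; rewrite ltr_pdivrMr// ltr_pdivlMr// => hc.
have M0 : 0 < M by rewrite ltr0n.
pose u := (f c * k.+2%:R - f t) / M.
have [|Cx _ ex] := itv_value p q u pq.
  by rewrite /u ltr_pdivlMr// ltr_pdivrMr//; lra.
have [[Ix _] [Ic _]] := (Cx, Cc).
have mx : amean f t (fun _ : 'I_k.+1 => hf u) = f c.
  rewrite amean_cst ex /u mulrCA mulfV ?mulr1 ?gt_eqF// addrC subrK.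
  by rewrite mulfK// gt_eqF.
have := mean_e t (fun=> hf u) It (fun=> Ix); rewrite mx (ginvK fP)// => /(_ Cc).
rewrite amean_cst (eC _ Cx) mulr0 addr0 => /eqP.
by rewrite mulf_eq0 invr_eq0 (gt_eqF n0) orbF => /eqP.
Qed.

(** One step of the descent may multiply the deficit from [ell] by [M]; the tolerances absorb
    exactly this factor. *)
Lemma eps_step j : M * (ell / 4 / M ^+ j.+1) = ell / 4 / M ^+ j.
Proof.
have M0 : M != 0 by rewrite pnatr_eq0.
by rewrite exprS invfM (mulrCA (ell / 4)) mulVKf.
Qed.

Lemma eps_le j : ell / 4 / M ^+ j <= ell / 4.
Proof.
have ell0 := max_len_gt0.
by rewrite ler_pdivrMr ?exprn_gt0// ler_peMr ?divr_ge0 ?(ltW ell0)// exprn_ege1.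
Qed.

Lemma near_long j p q : no_jump_itv I f hf p q ->
  ell - (f q - f p) <= ell / 4 / M ^+ j.+1 -> long p q.
Proof.
move=> pq near; split=> //; have ell0 := max_len_gt0.
have M0 : 0 < M by rewrite ltr0n.
have : M * (ell - (f q - f p)) <= ell / 4.
  by apply: le_trans (eps_le j); rewrite -eps_step ler_pM2l.
have : ell - (f q - f p) <= M * (ell - (f q - f p)).
  by rewrite ler_peMl// subr_ge0 len_le.
by lra.
Qed.

(* A nearly maximal interval forces a nearly maximal one strictly between it and [t]. *)
Lemma descent j p q : no_jump_itv I f hf p q ->
  ell - (f q - f p) <= ell / 4 / M ^+ j ->
  (t < p -> j%:R * (ell / 2) <= f p - f t) /\
  (q < t -> j%:R * (ell / 2) <= f t - f q).
Proof.
have ell0 := max_len_gt0.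
have M0 : 0 < M by rewrite ltr0n.
elim: j p q => [|j IH] p q pq near.
  have [Ip Iq] := no_jump_itv_in _ _ pq.
  by rewrite mul0r !subr_ge0; split=> h; rewrite ltW// (incr_lt fI).
have [Ip Iq] := no_jump_itv_in _ _ pq.
have [plq cpq] := pq.
have near' : M * (ell - (f q - f p)) <= ell / 4 / M ^+ j.
  by rewrite -eps_step ler_pM2l.
have Mj := eps_le j.
have lpq := near_long _ _ _ pq near.
pose A := (f t + M * f p) / k.+2%:R; pose B := (f t + M * f q) / k.+2%:R.
have fpq : f p < f q by rewrite (incr_lt fI).
have JA : J A by rewrite /A -amean_cst; exact: amean_conv.
have JB : J B by rewrite /B -amean_cst; exact: amean_conv.
have AB : A < B.
  by rewrite /A /B ltr_pM2r ?invr_gt0// ltrD2l ltr_pM2l.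
have [|s [y [z [sE Is nCs [Iy Iz yz lt gt] len]]]] := passage_gap A B JA JB AB.
  by move=> c Cc; apply: mean_t_avoid.
have nAB : k.+2%:R * (B - A) = M * (f q - f p).
  by rewrite /A /B -mulrBl mulrC divfK ?gt_eqF//; ring.
(* The total length of the passage is at least [M * (f q - f p)], and no deficit is negative, so
   each is at most [M] times that of [[p, q]]. *)
have lens i : ell - (f (z i) - f (y i)) <= ell / 4 / M ^+ j.
  apply: le_trans near'.
  have : ell - (f (z i) - f (y i)) <= \sum_(j < k.+1) (ell - (f (z j) - f (y j))).
    rewrite (bigD1 i)//= lerDl sumr_ge0// => l _.
    by rewrite subr_ge0; apply: len_sum_le.
  by rewrite sumrB sumr_const card_ord -mulr_natl; lra.
have nj i : no_jump_itv I f hf (y i) (z i).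
  by have [yzi|//] := yz i; have := lens i; rewrite yzi; lra.
have sP i : s < y i \/ z i < s.
  have [_ cyz] := nj i; have [ys|] := leP (y i) s; last by left.
  have [sz|] := leP s (z i); last by right.
  by case: nCs; apply: cyz; rewrite ys.
have Js : J ((A + B) / 2) by apply: (conv_between A B) => //; lra.
have hA : A * k.+2%:R = f t + M * f p by rewrite /A divfK// gt_eqF.
have hB : B * k.+2%:R = f t + M * f q by rewrite /B divfK// gt_eqF.
split=> [tp|qt].
  have ftp : f t < f p by rewrite (incr_lt fI).
  have sp : s < p.
    rewrite ltNge; apply/negP => ps; apply: nCs; apply: cpq; rewrite ps sE.
    apply: (ginv_lel fP) => //.
    have : B < f q by rewrite /B ltr_pdivrMr// nM; lra.
    by lra.
  (* The mean over [y] is below [f s], so not all the intervals lie above [s]; one below it lies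
     between [t] and [p]. *)
  have [i zs] : exists i, z i < s.
    apply: contrapT => none; move: lt; apply/negP; rewrite -leNgt.
    rewrite ler_pdivlMr// nM mulrDr mulr1 addrC lerD2l.
    rewrite mulr_natr -[X in _ *+ X](card_ord k.+1) -sumr_const.
    apply: ler_sum => i _; rewrite (incr_le fI)//.
    by have [/ltW//|zs] := sP i; case: none; exists i.
  have ty : t < y i.
    have [//|zt] := side_t _ _ (nj i).
    have := same_side_gt _ _ _ lpq (itv_mid _ _ (nj i)) tp.
    by have [yzi _] := nj i; lra.
  have [/(_ ty) IHi _] := IH _ _ (nj i) (lens i).
  have : f (z i) < f p by rewrite (incr_lt fI)//; lra.
  (* The new interval adds at least three quarters of [ell] to the distance from [f t]; half is
     claimed. *)
  by have := lens i; rewrite -(natr1 j); lra.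
have fqt : f q < f t by rewrite (incr_lt fI).
have qs : q < s.
  rewrite ltNge; apply/negP => sq; apply: nCs; apply: cpq; rewrite sq andbT sE.
  apply: (ginv_ler fP) => //.
  have : f p < A by rewrite /A ltr_pdivlMr// nM; lra.
  by lra.
have [i sy] : exists i, s < y i.
  apply: contrapT => none; move: gt; apply/negP; rewrite -leNgt.
  rewrite ler_pdivrMr// nM mulrDr mulr1 addrC lerD2r.
  rewrite mulr_natr -[X in _ *+ X](card_ord k.+1) -sumr_const.
  apply: ler_sum => i _; rewrite (incr_le fI)//.
  by have [sy|/ltW//] := sP i; case: none; exists i.
have zt : z i < t.
  have [ty|//] := side_t _ _ (nj i).
  have := same_side_lt _ _ _ lpq (itv_mid _ _ (nj i)) qt.
  by have [yzi _] := nj i; lra.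
have [_ /(_ zt) IHi] := IH _ _ (nj i) (lens i).
have : f q < f (y i) by rewrite (incr_lt fI)//; lra.
by have := lens i; rewrite -(natr1 j); lra.
Qed.

(** Intervals of arbitrarily small deficit exist, so [descent] puts some of them arbitrarily far
    from [t] in terms of [f], while one long interval bounds [f] on that side through [no_shift]. *)
Lemma defect_absurd : False.
Proof.
have ell0 := max_len_gt0.
have M0 : 0 < M by rewrite ltr0n.
have long_near j : exists p q, [/\ no_jump_itv I f hf p q, long p q &
    ell - (f q - f p) <= ell / 4 / M ^+ j.+1].
  have d0 : 0 < ell / 4 / M ^+ j.+1 by rewrite !divr_gt0// exprn_gt0.
  have [p [q [pq near]]] := len_near _ d0.
  by exists p, q; split=> //; exact: near_long near.
have [p [q [pq lpq _]]] := long_near 0%N.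
have [Ip Iq] := no_jump_itv_in _ _ pq.
have [Im _] := inner_sub _ (itv_mid _ _ pq).
set c := (p + q) / 2 in Im.
have Uc : U c by apply: itv_mid.
have [pltq _] := pq.
have fpq : f p < f q by rewrite (incr_lt fI).
have far D : exists p' q', [/\ no_jump_itv I f hf p' q',
    t < p' -> D < f p' - f t & q' < t -> D < f t - f q'].
  pose j := Num.truncn (D / (ell / 2)).
  have [p' [q' [pq' _ near]]] := long_near j.
  have [h1 h2] := descent _ _ _ pq' near.
  have Dj : D < j.+1%:R * (ell / 2).
    by rewrite -ltr_pdivrMr ?divr_gt0//; exact: truncnS_gt.
  by exists p', q'; split=> // h; [apply: lt_le_trans (h1 h)|apply: lt_le_trans (h2 h)].
have [tp|qt] := side_t _ _ pq.
  have tc : t < c by rewrite /c; lra.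
  have ftc : f t < f c by rewrite (incr_lt fI).
  have bound x : I x -> f x < f q + (f c - f t).
    move=> Ix; rewrite ltNge; apply/negP => hx.
    apply: (no_shift p q c) => //;
      apply: (conv_between (f p) (f x)); try exact: conv_image; lra.
  have [p' [q' [pq' h _]]] := far (f q + (f c - f t) - f t).
  have [Ip' _] := no_jump_itv_in _ _ pq'.
  have [tp'|qt'] := side_t _ _ pq'; first by have := h tp'; have := bound p' Ip'; lra.
  have := same_side_gt _ _ _ lpq (itv_mid _ _ pq') tp.
  by have [? _] := pq'; lra.
have ct : c < t by rewrite /c; lra.
have fct : f c < f t by rewrite (incr_lt fI).
have bound x : I x -> f p + (f c - f t) < f x.
  move=> Ix; rewrite ltNge; apply/negP => hx.
  apply: (no_shift p q c) => //;
    apply: (conv_between (f x) (f q)); try exact: conv_image; lra.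
have [p' [q' [pq' _ h]]] := far (f t - (f p + (f c - f t))).
have [_ Iq'] := no_jump_itv_in _ _ pq'.
have [tp'|qt'] := side_t _ _ pq'; last by have := h qt'; have := bound q' Iq'; lra.
have := same_side_lt _ _ _ lpq (itv_mid _ _ pq') qt.
by have [? _] := pq'; lra.
Qed.

End Defect.

(** * Translation between tuples and families, and the conclusion *)

Lemma seq_min_lt {R : realType} (k : nat) (y : k.+1.-tuple R) (x : R) :
  seq_min y < x <-> exists i, tnth y i < x.
Proof.
rewrite /seq_min big_tuple; split=> [lt|[i yix]].
  apply: contrapT => none; move: lt; apply/negP; rewrite -leNgt.
  have le i : x <= tnth y i by rewrite leNgt; apply/negP => ?; apply: none; exists i.
  apply/bigmin_geP; split=> //.
  (* The default of the big minimum is the head of the sequence, itself an entry. *)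
  by have := le ord0; rewrite (tnth_nth 0) nth0.
exact: le_lt_trans (bigmin_le _ i _) yix.
Qed.

Lemma seq_max_gt {R : realType} (k : nat) (y : k.+1.-tuple R) (x : R) :
  x < seq_max y <-> exists i, x < tnth y i.
Proof.
rewrite /seq_max big_tuple; split=> [lt|[i yix]].
  apply: contrapT => none; move: lt; apply/negP; rewrite -leNgt.
  have le i : tnth y i <= x by rewrite leNgt; apply/negP => ?; apply: none; exists i.
  apply/bigmax_leP; split=> //.
  by have := le ord0; rewrite (tnth_nth 0) nth0.
exact: lt_le_trans yix (le_bigmax _ _ i).
Qed.

Lemma qameanE {R : realType} (I : set R) (f : R -> R) (m : nat) (t : R) (y : m.-tuple R) :
  qamean I f [tuple of t :: y] = generalized_inverse I f (amean f t (tnth y)).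
Proof.
rewrite /qamean /amean big_ord_recl tnth0; congr (generalized_inverse I f ((_ + _) / _)).
by apply: eq_bigr => i _; rewrite tnthS.
Qed.

Lemma tuples_in_cons {R : realType} (I : set R) (m : nat) (t : R) (y : m.-tuple R) :
  I t -> (forall i, I (tnth y i)) -> tuples_in I [tuple of t :: y].
Proof. by move=> It Iy i; case: (unliftP ord0 i) => [j|] ->; rewrite ?tnthS ?tnth0. Qed.

Lemma internality_set_no_jump {R : realType} (I : set R) (f : R -> R) (k : nat) :
  is_interval I -> strictly_increasing_on I f ->
  internality_set I (@qamean R I f k.+2) = no_jump I f (generalized_inverse I f).
Proof.
move=> iI fI; have fP := generalized_inverseP iI fI.
apply/funext => x; apply/propext; rewrite -(internalP iI fI fP (k := k)).
split=> -[Ix intx]; (split; first by []); [move=> w Iw hw|move=> y Iy].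
  pose y := [tuple w i | i < k.+1].
  have yE : tnth y = w by apply/funext => i; rewrite tnth_mktuple.
  have [||all_x|/andP[/seq_min_lt lt /seq_max_gt gt]] := intx y.
  - by move=> i; rewrite yE.
  - by rewrite qameanE yE.
  - by left=> i; rewrite -yE.
  - by right; rewrite -yE.
rewrite qameanE => /(intx _ Iy)[|[lt gt]]; [by left|right].
by apply/andP; split; [apply/seq_min_lt|apply/seq_max_gt].
Qed.

(* The number of variables n is written m.+1. *)
Theorem theorem3p3 (R : realType) (I : set R) (f g : R -> R)
    (I_itv : is_interval I)
    (I_len : exists a b, [/\ I a, I b & a < b])
    (f_incr : strictly_increasing_on I f)
    (g_incr : strictly_increasing_on I g)
    (Hfg : exists m : nat,
      [/\ (2 <= m.+1)%N,
          forall x : m.+1.-tuple R, tuples_in I x ->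
            qamean I f x = qamean I g x,
          passable I (@qamean R I f m.+1) &
          attracting I 2 (@qamean R I f m.+1)
            (interior (internality_set I (@qamean R I f m.+1)))]) :
  exists alpha beta : R, forall x, I x -> f x = alpha * g x + beta.
Proof.
have [t0 [_ [It0 _ _]]] := I_len.
have [[|k] [// _ eq_mean pass_mean [_ attr_mean]]] := Hfg.
have fP := generalized_inverseP I_itv f_incr.
have gP := generalized_inverseP I_itv g_incr.
set hf := generalized_inverse I f in fP.
set hg := generalized_inverse I g in gP.
have int_eq := internality_set_no_jump I f k I_itv f_incr.
have mean_eq t (w : 'I_k.+1 -> R) : I t -> (forall i, I (w i)) ->
    hf (amean f t w) = hg (amean g t w).
  move=> It Iw; pose y := [tuple w i | i < k.+1].
  have yE : tnth y = w by apply/funext => i; rewrite tnth_mktuple.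
  have := eq_mean [tuple of t :: y]; rewrite !qameanE yE; apply.
  by apply: tuples_in_cons => // i; rewrite yE.
have pass t : I t -> passage k I f hf t.
  move=> /pass_mean[_ [y [z [Iy Iz yz]]]]; rewrite !qameanE => /andP[lt gt].
  exists (tnth y), (tnth z); split=> // i.
  have [->|[yzi sub]] := yz i; [by left|right; split=> // x hx].
  by have := sub x; rewrite int_eq; apply; rewrite /= in_itv.
have inner_int x : inner_no_jump I f hf x <->
    interior (internality_set I (@qamean R I f k.+2)) x.
  rewrite int_eq; split=> [[d d0 hd]|].
    apply/nbhs_ballP; exists d => // y; rewrite /ball/= => yx.
    by apply: hd; rewrite distrC.
  move=> /nbhs_ballP[d d0 hd]; exists d => // y yx.
  by apply: hd; rewrite /ball/= distrC.
have attract : pair_attracting k I f hf.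
  move=> x1 x2 /inner_int U1 /inner_int U2.
  have [|z [Iz zE Uz]] := attr_mean [tuple x1; x2].
    by move=> i; case: (unliftP ord0 i) => [j|] ->; rewrite ?tnthS ?tnth0// ord1 tnth0.
  (* The prefix condition on [z] fixes its head as [x1]. *)
  have zt : z = [tuple of x1 :: [tuple of behead z]].
    by case/tupleP: z zE {Iz Uz} => a z /= [-> _]; apply/val_inj.
  exists (tnth [tuple of behead z]); split.
  - by rewrite (tnth_nth 0)/= nth_behead -[RHS]/(nth 0 [:: x1; x2] 1) -zE nth_take.
  - by move=> i; have := Iz (lift ord0 i); rewrite {1}zt tnthS.
  - by apply/inner_int; move: Uz; rewrite {1}zt qameanE.
have [a a0 slope] := common_slope I_itv f_incr g_incr fP gP mean_eq pass attract t0 It0.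
have [K affC] := affine_on_no_jump I_itv f_incr g_incr fP gP mean_eq pass a0 slope t0 It0.
pose e x := g x - (a * f x + K).
have aff x : I x -> e x = 0.
  move=> Ix; apply: contrapT => ex.
  apply: (defect_absurd I_itv f_incr fP pass attract _ _ Ix ex).
    by move=> y Cy; rewrite /e affC// subrr.
  move=> y w Iy Iw Cm.
  have [fm gm] := mean_no_jump I_itv f_incr g_incr fP gP mean_eq y w Iy Iw Cm.
  have := affC _ Cm; rewrite fm gm => gfK.
  (* The mean of [e] is that of [g] minus that of [a f + K], and these agree because [g = a f + K]
     at the mean point. *)
  rewrite (@amean_lin _ _ e g (fun x => a * f x + K) 1 (-1) y y y w w w); try by [].
  - rewrite (@amean_lin _ _ (fun x => a * f x + K) f (fun=> K) a 1 y y y w w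
      (fun=> y)); try by [].
    + rewrite amean_cst gfK -{2}[K]mul1r -mulrDl nat1r (mulrC _ K) mulfK ?pnatr_eq0//.
      by ring.
    + by rewrite mul1r.
    + by move=> i; rewrite mul1r.
  - by rewrite /e; ring.
  - by move=> i; rewrite /e; ring.
exists a^-1, (- (a^-1 * K)) => x Ix.
have := aff x Ix; rewrite /e => /eqP; rewrite subr_eq0 => /eqP ->.
by field; rewrite gt_eqF.
Qed.
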